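(* Let $m$ be a nonnegative integer and let $f$ be an entire function on $\mathbb{C}$. Then $f$ belongs to the space $\mathcal{F}_{\psi_m}^\infty$ if and only if $$\sup_{z\in\mathbb{C}}\frac{|f'(z)|e^{-\psi_m(z)}}{1+\psi_m'(z)}<\infty,$$ and in this case the $\mathcal{F}_{\psi_m}^\infty$-norm of $f$ is estimated by $$\|f\|_{(m,\infty)}\simeq|f(0)|+\sup_{z\in\mathbb{C}}\frac{|f'(z)|e^{-\psi_m(z)}}{1+\psi_m'(z)}.$$
   Context: For a nonnegative integer $m$ put $\psi_m(z)=\frac12|z|^2-m\log(1+|z|)$, $z\in\mathbb{C}$. This is a radial function, and $\psi_m'(z)$ denotes its derivative with respect to the radius evaluated at $|z|$, i.e. $\psi_m'(z)=|z|-\frac{m}{1+|z|}$. The space $\mathcal{F}_{\psi_m}^\infty$ (growth type Fock–Sobolev space) consists of all entire functions $f$ with $$\|f\|_{(m,\infty)}\simeq\sup_{z\in\mathbb{C}}|f(z)|e^{-\psi_m(z)}<\infty.$$ Here $U\simeq V$ means that each of $U,V$ is bounded by a constant multiple of the other, with constants independent of $f$.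
   Formalization: The weight 1+ψ_m'(z) is replaced by 1+|ψ_m'(z)|: for m≥1 the printed weight vanishes on |z|=√m−1, so the claim fails for f(z)=z; the weights agree where ψ_m'≥0, and everywhere if m=0. *)

(* Defs.v *)
From Stdlib Require Import Reals Lra.
From Coquelicot Require Import Coquelicot.
Open Scope R_scope.

Definition psi_rad (m : nat) (r : R) : R := / 2 * r ^ 2 - INR m * ln (1 + r).

Definition psi (m : nat) (z : C) : R := psi_rad m (Cmod z).

Definition dpsi (m : nat) (z : C) : R := Derive (psi_rad m) (Cmod z).

Lemma dpsiE (m : nat) (z : C) : dpsi m z = Cmod z - INR m / (1 + Cmod z).
Proof.
  assert (Hz := Cmod_ge_0 z).
  unfold dpsi, psi_rad; apply is_derive_unique; auto_derive.
  - lra.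
  - field; lra.
Qed.

Definition entire (f : C -> C) : Prop := forall z : C, ex_derive f z.

(* [C_derive] only takes limits along horizontal lines; it is the complex
   derivative wherever [f] is complex differentiable. *)
Lemma entire_C_derive (f : C -> C) :
  entire f -> forall z : C, is_derive f z (C_derive f z).
Proof. intros Hf z; exact (C_derive_correct f z z (Hf z)). Qed.

Definition supC (g : C -> R) : Rbar :=
  Lub_Rbar (fun x : R => exists z : C, x = g z).

Definition fock_sup (m : nat) (f : C -> C) : Rbar :=
  supC (fun z => Cmod (f z) * exp (- psi m z)).

Definition fock_space (m : nat) (f : C -> C) : Prop :=
  entire f /\ Rbar_lt (fock_sup m f) p_infty.

(* On [fock_space m], where [fock_sup m f] is finite. *)
Definition fock_norm (m : nat) (f : C -> C) : R := real (fock_sup m f).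

(* The weight is [1 + |psi_m'|], not [1 + psi_m']: the latter vanishes on the
   circle (1 + |z|)^2 = m when m >= 1, so that dividing by it would make the
   supremum infinite for f(z) = z, which lies in the space.  The two weights
   agree wherever psi_m' >= 0, that is outside a disc, and everywhere if
   m = 0. *)
Definition fock_deriv_sup (m : nat) (f : C -> C) : Rbar :=
  supC (fun z =>
    Cmod (C_derive f z) * exp (- psi m z) / (1 + Rabs (dpsi m z))).

Definition comparable_on {T : Type} (P : T -> Prop) (U V : T -> R) : Prop :=
  exists c : R, 0 < c /\ forall x : T, P x -> U x <= c * V x /\ V x <= c * U x.

(* Main.v *)
(* If [|f| <= M exp psi], Cauchy's estimate on the disc of radius [1 / (1 + |z|)],
   on which [psi] varies by a bounded amount, bounds [|f' z|] by a multiple of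
   [M (1 + |z|) exp (psi z)], and [1 + |z|] is comparable to [1 + |psi' z|].
   Conversely, integrating [f'] along the ray from [0] to [z] works because
   [(1 + |psi'|) exp psi] is dominated by the derivative of
   [2 exp psi + L t], and [t] is at most a multiple of [exp psi].
   Cauchy's estimate is not available and [f'] is not known to be continuous, so
   it is derived from Goursat's theorem on rectangles, in the coordinate
   [s = log (w - z)]. *)

Require Import Defs.
From Stdlib Require Import Reals Lra Classical ClassicalEpsilon.
From Coquelicot Require Import Coquelicot.
Open Scope R_scope.

(** * Complex differentiability and the complex exponential *)

Lemma exp_le_compat (x y : R) : x <= y -> exp x <= exp y.
Proof. intros [H| ->]; [left; now apply exp_increasing|right; reflexivity]. Qed.

Lemma Cmod_le_Rabs (z : C) : Cmod z <= Rabs (fst z) + Rabs (snd z).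
Proof.
  destruct z as [a b]; unfold Cmod; simpl.
  apply Rsqr_incr_0_var.
  - rewrite Rsqr_sqrt by nra.
    unfold Rsqr; assert (Ha := Rabs_pos a); assert (Hb := Rabs_pos b).
    assert (E1 : Rabs a * Rabs a = a * a) by (rewrite <- Rabs_mult; apply Rabs_pos_eq; nra).
    assert (E2 : Rabs b * Rabs b = b * b) by (rewrite <- Rabs_mult; apply Rabs_pos_eq; nra).
    nra.
  - assert (Ha := Rabs_pos a); assert (Hb := Rabs_pos b); lra.
Qed.

(** The neighbourhood filter of [z] has [z] as its only limit point, so the quantifier over limit
    points in the filter derivative collapses. The explicit error estimates below all go through
    this form. *)
Lemma is_derive_C_iff (f : C -> C) (z d : C) :
  is_derive (K := C_AbsRing) (V := C_NormedModule) f z d <->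
  forall eps : R, 0 < eps -> exists delta : R, 0 < delta /\
    forall w : C, Cmod (w - z) < delta ->
      Cmod (f w - f z - (w - z) * d) <= eps * Cmod (w - z).
Proof.
  split.
  - intros [_ H] eps Heps.
    destruct (H z (fun P HP => HP) (mkposreal eps Heps)) as [delta Hd].
    exists delta; split; [apply cond_pos|].
    intros w Hw; exact (Hd w Hw).
  - intros H; split.
    + apply is_linear_scal_l.
    + intros x Hx.
      assert (E : z = x).
      { apply (is_filter_lim_locally_unique (K := C_AbsRing)
          (V := AbsRing_NormedModule C_AbsRing)); exact Hx. }
      rewrite <- E.
      intros eps.
      destruct (H eps (cond_pos eps)) as [delta [Hd0 Hd]].
      exists (mkposreal delta Hd0); intros w Hw; exact (Hd w Hw).
Qed.

Definition cexp (z : C) : C := (exp (fst z) * cos (snd z), exp (fst z) * sin (snd z)).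

Lemma differentiable_pt_lim_exp_mul (g : R -> R) (x y l : R) :
  is_derive g y l ->
  differentiable_pt_lim (fun u v => exp u * g v) x y (exp x * g y) (exp x * l).
Proof.
  intros Hg.
  apply filterdiff_differentiable_pt_lim.
  eapply filterdiff_ext_lin.
  - apply (filterdiff_mult_fct (K := R_AbsRing) (fun u : R * R => exp (fst u))
      (fun u : R * R => g (snd u)) (x, y)).
    + intros; apply Rmult_comm.
    + apply (filterdiff_comp' (fst : R * R -> R) exp (x, y)).
      * apply filterdiff_linear, is_linear_fst.
      * apply is_derive_exp.
    + apply (filterdiff_comp' (snd : R * R -> R) g (x, y)).
      * apply filterdiff_linear, is_linear_snd.
      * exact Hg.
  - intros [u v]; simpl.
    unfold plus, mult, scal; simpl; unfold mult; simpl; ring.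
Qed.

(** Both components are real differentiable, each with error at most [eps / 2] times the max norm of
    the increment. By the Cauchy-Riemann equations their differentials together are multiplication
    by [cexp z]. *)
Lemma is_derive_cexp (z : C) :
  is_derive (K := C_AbsRing) (V := C_NormedModule) cexp z (cexp z).
Proof.
  apply is_derive_C_iff; intros eps Heps.
  destruct z as [x y].
  assert (H2 : 0 < eps / 2) by lra.
  destruct (differentiable_pt_lim_exp_mul cos x y _ (is_derive_cos y)
    (mkposreal _ H2)) as [d1 H1].
  destruct (differentiable_pt_lim_exp_mul sin x y _ (is_derive_sin y)
    (mkposreal _ H2)) as [d2 H3].
  exists (Rmin d1 d2); split; [apply Rmin_pos; apply cond_pos|].
  intros [u v] Hw.
  change ((u, v) - (x, y))%C with ((u - x, v - y) : C) in *.
  assert (Hm : Rmax (Rabs (u - x)) (Rabs (v - y)) <= Cmod (u - x, v - y))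
    by exact (Rmax_Cmod (u - x, v - y)).
  assert (Hu : Rabs (u - x) < Rmin d1 d2).
  { eapply Rle_lt_trans; [|exact Hw]. eapply Rle_trans; [|exact Hm]. apply Rmax_l. }
  assert (Hv : Rabs (v - y) < Rmin d1 d2).
  { eapply Rle_lt_trans; [|exact Hw]. eapply Rle_trans; [|exact Hm]. apply Rmax_r. }
  assert (L1 := Rmin_l d1 d2); assert (L2 := Rmin_r d1 d2).
  specialize (H1 u v ltac:(lra) ltac:(lra)).
  specialize (H3 u v ltac:(lra) ltac:(lra)).
  simpl in H1, H3.
  eapply Rle_trans; [apply Cmod_le_Rabs|].
  unfold cexp; simpl.
  match type of H1 with Rabs ?a <= _ =>
    match goal with |- Rabs ?b + _ <= _ => replace b with a by ring end end.
  match type of H3 with Rabs ?a <= _ =>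
    match goal with |- _ + Rabs ?b <= _ => replace b with a by ring end end.
  nra.
Qed.

Lemma Cmod_cexp (z : C) : Cmod (cexp z) = exp (fst z).
Proof.
  unfold cexp, Cmod; simpl.
  replace (_ + _) with (Rsqr (exp (fst z))).
  - apply sqrt_Rsqr, Rlt_le, exp_pos.
  - assert (H := sin2_cos2 (snd z)); unfold Rsqr in *.
    replace (exp (fst z) * exp (fst z)) with
      (exp (fst z) * exp (fst z) * (sin (snd z) * sin (snd z) + cos (snd z) * cos (snd z)))
      by (rewrite H; ring).
    ring.
Qed.

Lemma cexp_neq_0 (z : C) : cexp z <> RtoC 0.
Proof.
  intros E; assert (H := Cmod_cexp z); rewrite E, Cmod_0 in H.
  assert (P := exp_pos (fst z)); lra.
Qed.

Lemma cexp_opp (z : C) : cexp (- z) = (/ cexp z)%C.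
Proof.
  assert (H : (cexp z * cexp (- z))%C = RtoC 1).
  { unfold cexp, Cmult, Copp, RtoC; simpl.
    rewrite cos_neg, sin_neg, exp_Ropp.
    assert (P := exp_pos (fst z)).
    assert (S := sin2_cos2 (snd z)); unfold Rsqr in S.
    f_equal; [|field; lra].
    rewrite <- S; field; lra. }
  replace (cexp (- z))%C with (/ cexp z * (cexp z * cexp (- z)))%C.
  - rewrite H; ring.
  - field; apply cexp_neq_0.
Qed.

Lemma cexp_2PI (x : R) : cexp (x, 2 * PI) = cexp (x, 0).
Proof. unfold cexp; simpl; now rewrite cos_2PI, sin_2PI, cos_0, sin_0. Qed.

(* [is_derive_mult] and [is_derive_comp] are about the canonical module structure
   of [C_AbsRing], which does not unify with [C_NormedModule]. *)
Lemma is_derive_C_AbsRing (f : C -> C) (z d : C) :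
  is_derive (K := C_AbsRing) (V := C_NormedModule) f z d <->
  is_derive (K := C_AbsRing) (V := AbsRing_NormedModule C_AbsRing) f z d.
Proof.
  split; intros [_ H]; (split; [apply is_linear_scal_l|]);
    intros x Hx eps; exact (H x Hx eps).
Qed.

(** * Goursat's theorem on rectangles *)

(** If [P] failed on a rectangle, it would fail on one of its four quarters, and so on. The nested
    failing quarters shrink to a point [(p, q)], where the local hypothesis is contradicted. *)
Lemma rectangle_bisection (P : R -> R -> R -> R -> Prop) :
  (forall x y w h, 0 <= w -> 0 <= h ->
     P x y w h -> P (x + w) y w h -> P x (y + h) w h -> P (x + w) (y + h) w h ->
     P x y (2 * w) (2 * h)) ->
  (forall p q, exists delta, 0 < delta /\ forall x y w h,
     x <= p <= x + w -> y <= q <= y + h -> w < delta -> h < delta -> P x y w h) ->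
  forall x y w h, 0 <= w -> 0 <= h -> P x y w h.
Proof.
  intros Hsplit Hloc x0 y0 w h Hw Hh.
  apply NNPP; intros Hbad.
  set (W n := w / 2 ^ n); set (H n := h / 2 ^ n).
  assert (H2 : forall n, 0 < 2 ^ n) by (intros; apply pow_lt; lra).
  assert (HW : forall n, 0 <= W n /\ W n = 2 * W (S n)).
  { intros n; unfold W; specialize (H2 n); split.
    - apply Rmult_le_pos; [lra|left; now apply Rinv_0_lt_compat].
    - simpl; field; lra. }
  assert (HH : forall n, 0 <= H n /\ H n = 2 * H (S n)).
  { intros n; unfold H; specialize (H2 n); split.
    - apply Rmult_le_pos; [lra|left; now apply Rinv_0_lt_compat].
    - simpl; field; lra. }
  (* The failure of [P] is assumed under the existential, so that choice turns this into a total
     function on corners, which can be iterated. *)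
  assert (Hstep : forall (n : nat) (c : R * R), exists c' : R * R,
    ~ P (fst c) (snd c) (W n) (H n) ->
    ~ P (fst c') (snd c') (W (S n)) (H (S n)) /\
    fst c <= fst c' <= fst c + W (S n) /\ snd c <= snd c' <= snd c + H (S n)).
  { intros n [x y]; simpl.
    destruct (HW n) as [_ E1]; destruct (HH n) as [_ E2].
    destruct (HW (S n)) as [P1 _]; destruct (HH (S n)) as [P2 _].
    set (a := W (S n)) in *; set (b := H (S n)) in *.
    destruct (classic (P x y a b)) as [A1|A1];
      [|exists (x, y); simpl; intros _; repeat split; auto; lra].
    destruct (classic (P (x + a) y a b)) as [A2|A2];
      [|exists (x + a, y); simpl; intros _; repeat split; auto; lra].
    destruct (classic (P x (y + b) a b)) as [A3|A3];
      [|exists (x, y + b); simpl; intros _; repeat split; auto; lra].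
    destruct (classic (P (x + a) (y + b) a b)) as [A4|A4];
      [|exists (x + a, y + b); simpl; intros _; repeat split; auto; lra].
    exists (x, y); intros B; exfalso; apply B; rewrite E1, E2; auto. }
  set (step n c := proj1_sig (constructive_indefinite_description _ (Hstep n c))).
  set (c := fix c n := match n with O => (x0, y0) | S n => step n (c n) end).
  assert (Hc : forall n, ~ P (fst (c n)) (snd (c n)) (W n) (H n)).
  { induction n as [|n IH]; simpl.
    - unfold W, H; simpl; now rewrite !Rdiv_1_r.
    - unfold step; destruct constructive_indefinite_description as [c' Hc']; simpl.
      now apply Hc'. }
  assert (Hcs : forall n, fst (c n) <= fst (c (S n)) <= fst (c n) + W (S n) /\
    snd (c n) <= snd (c (S n)) <= snd (c n) + H (S n)).
  { intros n; simpl; unfold step.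
    destruct constructive_indefinite_description as [c' Hc']; simpl.
    now apply Hc'. }
  (* Nested intervals: every left end lies below every right end, so the supremum of the left ends
     lies in all of them. *)
  assert (nest : forall (u s : nat -> R),
    (forall n, 0 <= s n /\ s n = 2 * s (S n)) ->
    (forall n, u n <= u (S n) <= u n + s (S n)) ->
    exists l, forall n, u n <= l <= u n + s n).
  { intros u s Hs Hu.
    assert (Hk : forall n k, u n <= u (n + k)%nat /\ u (n + k)%nat + s (n + k)%nat <= u n + s n).
    { intros n; induction k as [|k IH]; rewrite ?Nat.add_0_r, ?Nat.add_succ_r; [lra|].
      specialize (Hu (n + k)%nat); specialize (Hs (n + k)%nat); lra. }
    assert (Hmn : forall i j, u i <= u j + s j).
    { intros i j.
      destruct (Hk i j) as [A _]; destruct (Hk j i) as [_ B].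
      rewrite Nat.add_comm in B; specialize (Hs (i + j)%nat); lra. }
    destruct (completeness (fun x => exists n, x = u n)) as [l [L1 L2]].
    - exists (u O + s O); intros x [n ->]; apply Hmn.
    - now exists (u O), O.
    - exists l; intros n; split.
      + apply L1; now exists n.
      + apply L2; intros x [k ->]; apply Hmn. }
  destruct (nest (fun n => fst (c n)) W HW (fun n => proj1 (Hcs n))) as [p Hp].
  destruct (nest (fun n => snd (c n)) H HH (fun n => proj2 (Hcs n))) as [q Hq].
  destruct (Hloc p q) as [delta [Hd0 Hd]].
  assert (small : exists n, W n < delta /\ H n < delta).
  (* Once [2 ^ (- n)] is below this quotient, both sides are shorter than [delta]; the [+ 1] keeps
     the denominator positive for a degenerate rectangle. *)
  { assert (Hx : 0 < delta / (w + h + 1)) by (apply Rdiv_lt_0_compat; lra).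
    destruct (pow_lt_1_zero (/ 2) ltac:(rewrite Rabs_pos_eq; lra) _ Hx) as [n Hn].
    exists n; specialize (Hn n (le_n n)).
    assert (P0 : 0 < / 2 ^ n) by (apply Rinv_0_lt_compat, H2).
    rewrite pow_inv, Rabs_pos_eq in Hn by lra.
    apply (Rmult_lt_compat_r (w + h + 1)) in Hn; [|lra].
    replace (delta / (w + h + 1) * (w + h + 1)) with delta in Hn by (field; lra).
    unfold W, H, Rdiv; split; nra. }
  destruct small as [n [S1 S2]].
  apply (Hc n), Hd; auto.
Qed.

(** Differentiability with error constant 1 gives increments of [G] at [c t] of at most [1 + Cmod d]
    times the distance. The path [c] will be a horizontal or vertical line and [k] a real or
    imaginary part. *)
Lemma entire_continuous_component (G : C -> C) (k : C -> R) (c : R -> C) :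
  (forall z w, Rabs (k z - k w) <= Cmod (z - w)) ->
  (forall s t, Cmod (c s - c t) = Rabs (s - t)) ->
  entire G -> forall t, continuous (fun s => k (G (c s))) t.
Proof.
  intros Hk Hc HG t.
  apply continuity_pt_filterlim; intros eps Heps.
  destruct (proj1 (is_derive_C_iff G (c t) _) (entire_C_derive G HG (c t)) 1 Rlt_0_1)
    as [delta [Hd0 Hd]].
  set (d := C_derive G (c t)) in *.
  assert (Hd1 := Cmod_ge_0 d).
  assert (Hpos : 0 < eps / (2 + Cmod d)) by (apply Rdiv_lt_0_compat; lra).
  exists (Rmin delta (eps / (2 + Cmod d))); split; [now apply Rmin_pos|].
  intros s [_ Hs]; simpl in *; unfold R_dist in *.
  assert (L1 := Rmin_l delta (eps / (2 + Cmod d))).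
  assert (L2 := Rmin_r delta (eps / (2 + Cmod d))).
  assert (Hs1 : Cmod (c s - c t) < delta) by (rewrite Hc; lra).
  specialize (Hd _ Hs1).
  assert (T := Cmod_triangle (G (c s) - G (c t) - (c s - c t) * d) ((c s - c t) * d)).
  replace (G (c s) - G (c t) - (c s - c t) * d + (c s - c t) * d)%C
    with (G (c s) - G (c t))%C in T by ring.
  rewrite Cmod_mult, Hc in T; rewrite Hc in Hd.
  eapply Rle_lt_trans; [apply Hk|].
  assert (Hs2 : Rabs (s - t) < eps / (2 + Cmod d)) by lra.
  apply (Rmult_lt_compat_r (2 + Cmod d)) in Hs2; [|lra].
  replace (eps / (2 + Cmod d) * (2 + Cmod d)) with eps in Hs2 by (field; lra).
  assert (Hp := Rabs_pos (s - t)); nra.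
Qed.

Lemma Rabs_fst_le (z w : C) : Rabs (fst z - fst w) <= Cmod (z - w).
Proof.
  eapply Rle_trans; [|apply Rmax_Cmod]; apply Rmax_l.
Qed.

Lemma Rabs_snd_le (z w : C) : Rabs (snd z - snd w) <= Cmod (z - w).
Proof.
  eapply Rle_trans; [|apply Rmax_Cmod]; apply Rmax_r.
Qed.

Lemma Cmod_vert (x s t : R) : Cmod ((x, s) - (x, t)) = Rabs (s - t).
Proof.
  unfold Cmod; simpl; rewrite <- sqrt_Rsqr_abs; f_equal; unfold Rsqr; ring.
Qed.

Lemma Cmod_horiz (y s t : R) : Cmod ((s, y) - (t, y)) = Rabs (s - t).
Proof.
  unfold Cmod; simpl; rewrite <- sqrt_Rsqr_abs; f_equal; unfold Rsqr; ring.
Qed.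

(** Meant for integrands [f] and [g] on two parallel sides of a rectangle, whose difference is known
    to be close to a constant. *)
Lemma RInt_diff_const (f g : R -> R) (a l k e : R) :
  0 <= l -> ex_RInt f a (a + l) -> ex_RInt g a (a + l) ->
  (forall t, a <= t <= a + l -> Rabs (f t - g t - k) <= e) ->
  Rabs (RInt f a (a + l) - RInt g a (a + l) - k * l) <= l * e.
Proof.
  intros Hl Hf Hg H.
  assert (Hc : ex_RInt (fun _ : R => k) a (a + l))
    by apply (ex_RInt_const (V := R_NormedModule)).
  assert (Hfg : ex_RInt (fun t => f t - g t) a (a + l))
    by exact (ex_RInt_minus (V := R_NormedModule) f g a (a + l) Hf Hg).
  assert (Hx : ex_RInt (fun t => f t - g t - k) a (a + l))
    by exact (ex_RInt_minus (V := R_NormedModule) _ _ a (a + l) Hfg Hc).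
  assert (E1 : RInt (fun t => f t - g t) a (a + l) = RInt f a (a + l) - RInt g a (a + l))
    by exact (RInt_minus (V := R_CompleteNormedModule) f g a (a + l) Hf Hg).
  assert (E2 : RInt (fun t => f t - g t - k) a (a + l) =
    RInt (fun t => f t - g t) a (a + l) - RInt (fun _ => k) a (a + l))
    by exact (RInt_minus (V := R_CompleteNormedModule) _ _ a (a + l) Hfg Hc).
  assert (E3 : RInt (fun _ : R => k) a (a + l) = k * l).
  { replace (k * l) with ((a + l - a) * k) by ring.
    exact (RInt_const (V := R_CompleteNormedModule) a (a + l) k). }
  rewrite <- E1, <- E3, <- E2.
  replace (l * e) with ((a + l - a) * e) by ring.
  apply abs_RInt_le_const; auto; lra.
Qed.

(** On a vertical side [dz = i dt], so the imaginary part of the contour integral takes the real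
    part of [G] there, and the imaginary part of [G] on horizontal sides. One real component is
    enough because a conjugate factor will make the relevant limit real. *)
Definition vert_int (G : C -> C) (x y h : R) : R :=
  RInt (fun t => fst (G (x, t))) y (y + h).

Definition horiz_int (G : C -> C) (x y w : R) : R :=
  RInt (fun s => snd (G (s, y))) x (x + w).

(* The imaginary part of the contour integral of [G] along the boundary of
   [x, x + w] * [y, y + h]. *)
Definition rect_int (G : C -> C) (x y w h : R) : R :=
  vert_int G (x + w) y h - vert_int G x y h
  - (horiz_int G x (y + h) w - horiz_int G x y w).

Section Goursat.

Context (G : C -> C) (HG : entire G).

Lemma ex_RInt_vert (x a b : R) : ex_RInt (fun t => fst (G (x, t))) a b.
Proof.
  apply (ex_RInt_continuous (V := R_CompleteNormedModule)); intros t _.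
  apply (entire_continuous_component G fst (fun t => (x, t))); auto.
  - apply Rabs_fst_le.
  - intros; apply Cmod_vert.
Qed.

Lemma ex_RInt_horiz (y a b : R) : ex_RInt (fun s => snd (G (s, y))) a b.
Proof.
  apply (ex_RInt_continuous (V := R_CompleteNormedModule)); intros t _.
  apply (entire_continuous_component G snd (fun t => (t, y))); auto.
  - apply Rabs_snd_le.
  - intros; apply Cmod_horiz.
Qed.

Lemma vert_int_double (x y h : R) :
  vert_int G x y (2 * h) = vert_int G x y h + vert_int G x (y + h) h.
Proof.
  unfold vert_int; replace (y + 2 * h) with (y + h + h) by ring.
  symmetry; apply (RInt_Chasles (V := R_CompleteNormedModule)); apply ex_RInt_vert.
Qed.

Lemma horiz_int_double (x y w : R) :
  horiz_int G x y (2 * w) = horiz_int G x y w + horiz_int G (x + w) y w.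
Proof.
  unfold horiz_int; replace (x + 2 * w) with (x + w + w) by ring.
  symmetry; apply (RInt_Chasles (V := R_CompleteNormedModule)); apply ex_RInt_horiz.
Qed.

Lemma rect_int_split (x y w h : R) :
  rect_int G x y (2 * w) (2 * h) =
  rect_int G x y w h + rect_int G (x + w) y w h
  + rect_int G x (y + h) w h + rect_int G (x + w) (y + h) w h.
Proof.
  unfold rect_int; rewrite !vert_int_double, !horiz_int_double.
  replace (x + 2 * w) with (x + w + w) by ring.
  replace (y + 2 * h) with (y + h + h) by ring.
  ring.
Qed.

(** With [G' (p, q) = a + i b], the linear part contributes [w * a * h] to the vertical sides and
    [h * a * w] to the horizontal ones, which cancel. The remainders add up to at most
    [h * eps * (w + h) + w * eps * (w + h)]. *)
Lemma rect_int_local (p q eps : R) : 0 < eps ->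
  exists delta, 0 < delta /\ forall x y w h,
    x <= p <= x + w -> y <= q <= y + h -> w < delta -> h < delta ->
    Rabs (rect_int G x y w h) <= eps * (w + h) ^ 2.
Proof.
  intros Heps.
  assert (H2 : 0 < eps / 2) by lra.
  destruct (proj1 (is_derive_C_iff G (p, q) _) (entire_C_derive G HG (p, q)) _ H2)
    as [delta [Hd0 Hd]].
  destruct (C_derive G (p, q)) as [a b].
  (* Points of the rectangle are within [w + h] of [(p, q)], which is then less than [delta]. *)
  exists (delta / 2); split; [lra|].
  intros x y w h Hx Hy Hw Hh.
  assert (lin : forall s t, x <= s <= x + w -> y <= t <= y + h ->
    Rabs (fst (G (s, t)) - fst (G (p, q)) - ((s - p) * a - (t - q) * b)) <= eps / 2 * (w + h) /\
    Rabs (snd (G (s, t)) - snd (G (p, q)) - ((s - p) * b + (t - q) * a)) <= eps / 2 * (w + h)).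
  { intros s t Hs Ht.
    assert (B : Cmod ((s, t) - (p, q)) <= w + h).
    { eapply Rle_trans; [apply Cmod_le_Rabs|]; simpl.
      assert (Rabs (s + - p) <= w) by (apply Rabs_le; lra).
      assert (Rabs (t + - q) <= h) by (apply Rabs_le; lra).
      lra. }
    specialize (Hd (s, t) ltac:(lra)).
    assert (M := Rmax_Cmod (G (s, t) - G (p, q) - ((s, t) - (p, q)) * (a, b))%C).
    assert (M1 := Rmax_l (Rabs (fst (G (s, t) - G (p, q) - ((s, t) - (p, q)) * (a, b))%C))
      (Rabs (snd (G (s, t) - G (p, q) - ((s, t) - (p, q)) * (a, b))%C))).
    assert (M2 := Rmax_r (Rabs (fst (G (s, t) - G (p, q) - ((s, t) - (p, q)) * (a, b))%C))
      (Rabs (snd (G (s, t) - G (p, q) - ((s, t) - (p, q)) * (a, b))%C))).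
    assert (Hle : eps / 2 * Cmod ((s, t) - (p, q)) <= eps / 2 * (w + h))
      by (apply Rmult_le_compat_l; lra).
    split; (eapply Rle_trans; [|eapply Rle_trans; [|exact Hle]];
      [|eapply Rle_trans; [|exact Hd]; eapply Rle_trans; [|exact M]]);
      [|exact M1| |exact M2]; right; f_equal; simpl; ring. }
  assert (V : Rabs (vert_int G (x + w) y h - vert_int G x y h - w * a * h)
    <= h * (eps * (w + h))).
  { apply RInt_diff_const; try apply ex_RInt_vert; [lra|].
    intros t Ht.
    destruct (lin (x + w) t ltac:(lra) Ht) as [A _].
    destruct (lin x t ltac:(lra) Ht) as [A' _].
    apply Rabs_le_between in A; apply Rabs_le_between in A'.
    apply Rabs_le; lra. }
  assert (H : Rabs (horiz_int G x (y + h) w - horiz_int G x y w - h * a * w)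
    <= w * (eps * (w + h))).
  { apply RInt_diff_const; try apply ex_RInt_horiz; [lra|].
    intros s Hs.
    destruct (lin s (y + h) Hs ltac:(lra)) as [_ A].
    destruct (lin s y Hs ltac:(lra)) as [_ A'].
    apply Rabs_le_between in A; apply Rabs_le_between in A'.
    apply Rabs_le; lra. }
  unfold rect_int.
  apply Rabs_le_between in V; apply Rabs_le_between in H.
  apply Rabs_le; nra.
Qed.

(** The bound [eps * (w + h) ^ 2] is compatible with bisection: doubling both sides multiplies it by
    4, the number of quarters. Hence it passes from small rectangles to all of them, for every
    [eps]. *)
Lemma goursat_rectangle (x y w h : R) :
  0 <= w -> 0 <= h -> rect_int G x y w h = 0.
Proof.
  intros Hw Hh.
  assert (B : forall eps, 0 < eps -> Rabs (rect_int G x y w h) <= eps * (w + h) ^ 2).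
  { intros eps Heps; revert x y w h Hw Hh.
    apply (rectangle_bisection (fun x y w h => Rabs (rect_int G x y w h) <= eps * (w + h) ^ 2)).
    - intros x y w h Hw Hh P1 P2 P3 P4; rewrite rect_int_split.
      apply Rabs_le_between in P1; apply Rabs_le_between in P2.
      apply Rabs_le_between in P3; apply Rabs_le_between in P4.
      apply Rabs_le; lra.
    - intros p q; apply rect_int_local, Heps. }
  apply NNPP; intros Hne.
  assert (HD := Rabs_pos_lt _ Hne).
  assert (Hs : 0 <= (w + h) ^ 2) by apply pow2_ge_0.
  set (d := Rabs (rect_int G x y w h)) in *.
  (* This [eps] makes the bound smaller than [d], also when [w + h = 0]. *)
  specialize (B (d / (2 * ((w + h) ^ 2 + 1))) ltac:(apply Rdiv_lt_0_compat; lra)).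
  apply (Rmult_le_compat_r (2 * ((w + h) ^ 2 + 1))) in B; [|lra].
  replace (d / (2 * ((w + h) ^ 2 + 1)) * (w + h) ^ 2 * (2 * ((w + h) ^ 2 + 1)))
    with (d * (w + h) ^ 2) in B by (field; lra).
  nra.
Qed.

(** By periodicity the top and bottom sides cancel in Goursat's theorem, leaving only the two
    vertical sides. *)
Lemma periodic_vert_int (x w : R) : 0 <= w ->
  (forall s, G (s, 2 * PI) = G (s, 0)) ->
  vert_int G (x + w) 0 (2 * PI) = vert_int G x 0 (2 * PI).
Proof.
  intros Hw Hper.
  assert (HPI := PI_RGT_0).
  assert (E := goursat_rectangle x 0 w (2 * PI) Hw ltac:(lra)).
  unfold rect_int in E.
  replace (horiz_int G x (0 + 2 * PI) w) with (horiz_int G x 0 w) in E; [lra|].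
  apply RInt_ext; intros s _; now rewrite Rplus_0_l, Hper.
Qed.

End Goursat.

(** * Cauchy's estimate for the derivative *)

(** In the coordinate [s] the difference quotient at [z] has no singularity, since [cexp] never
    vanishes. Multiplying by [cexp (- s)] rather than dividing reduces the claim to the product and
    chain rules. *)
Lemma entire_log_quotient (f : C -> C) (z c : C) : entire f ->
  entire (fun s => c * ((f (z + cexp s) - f z) * cexp (- s)))%C.
Proof.
  intros Hf s.
  assert (Dexp := fun s => proj1 (is_derive_C_AbsRing _ _ _) (is_derive_cexp s)).
  assert (Df := fun s => proj1 (is_derive_C_AbsRing _ _ _) (entire_C_derive f Hf s)).
  assert (Dc := fun c : C => is_derive_const (K := C_AbsRing)
    (V := AbsRing_NormedModule C_AbsRing) c s).
  assert (D0 := is_derive_plus (K := C_AbsRing) (V := AbsRing_NormedModule C_AbsRing)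
    _ _ s _ _ (Dc z) (Dexp s)).
  assert (D1 := is_derive_comp (K := C_AbsRing) (V := AbsRing_NormedModule C_AbsRing)
    _ _ s _ _ (Df (z + cexp s)%C) D0).
  assert (D2 := is_derive_comp (K := C_AbsRing) (V := AbsRing_NormedModule C_AbsRing)
    _ _ s _ _ (Dexp (- s)%C) (is_derive_opp _ s _ (is_derive_id s))).
  assert (D3 := is_derive_minus (K := C_AbsRing) (V := AbsRing_NormedModule C_AbsRing)
    _ _ s _ _ D1 (Dc (f z))).
  assert (D4 := is_derive_mult (K := C_AbsRing) _ _ s _ _ D3 D2 Cmult_comm).
  assert (D5 := is_derive_mult (K := C_AbsRing) _ _ s _ _ (Dc c) D4 Cmult_comm).
  eexists; apply is_derive_C_AbsRing; exact D5.
Qed.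

Lemma Cconj_mult_self (d : C) : (Cconj d * d)%C = RtoC (Cmod d * Cmod d).
Proof.
  destruct d as [a b]; unfold Cmod; simpl.
  rewrite sqrt_sqrt by nra.
  unfold Cmult, Cconj, RtoC; simpl; f_equal; ring.
Qed.

(* With [s = x + i t], the function [(f (z + exp s) - f z) / exp s] is entire
   and [2 i pi]-periodic, so its mean over a vertical period does not depend on
   [x]; as [x] tends to [-oo] that mean tends to [f' z]. *)
Lemma cauchy_estimate (f : C -> C) (z : C) (r M : R) :
  entire f -> 0 < r -> (forall w, Cmod (w - z) <= r -> Cmod (f w) <= M) ->
  Cmod (C_derive f z) <= 2 * M / r.
Proof.
  intros Hf Hr HM.
  set (d := C_derive f z).
  assert (Hd := Cmod_ge_0 d).
  assert (Hz : Cmod (f z) <= M).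
  { apply HM; replace (z - z)%C with (RtoC 0) by ring; rewrite Cmod_0; lra. }
  assert (HM0 := Cmod_ge_0 (f z)).
  assert (Hq : 0 <= 2 * M / r) by (apply Rmult_le_pos; [lra|left; now apply Rinv_0_lt_compat]).
  (* For [d = 0] the bound is trivial; otherwise a factor [Cmod d] can be cancelled at the end. *)
  destruct Hd as [Hd|Hd]; [|lra].
  apply le_epsilon; intros eps Heps.
  destruct (proj1 (is_derive_C_iff f z d) (entire_C_derive f Hf z) eps Heps)
    as [delta [Hdel Hlin]].
  (* The factor [Cconj d] turns the limit [d] of the quotient into the real number [Cmod d ^ 2], so
     that the real part retains the full modulus. *)
  set (G := (fun s => Cconj d * ((f (z + cexp s) - f z) * cexp (- s)))%C).
  assert (HG : entire G) by now apply entire_log_quotient.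
  (* The line at [x1] is the circle of radius [r], where the bound [M] applies; the line at [x0] is
     a circle so small that the quotient is within [eps] of [d]. *)
  set (x1 := ln r); set (x0 := Rmin x1 (ln (delta / 2))).
  assert (E1 : exp x1 = r) by now apply exp_ln.
  assert (E0 : exp x0 < delta).
  { apply Rle_lt_trans with (exp (ln (delta / 2))); [|rewrite exp_ln; lra].
    apply exp_le_compat, Rmin_r. }
  assert (Hx : x0 <= x1) by apply Rmin_l.
  assert (HPI := PI_RGT_0).
  assert (I := periodic_vert_int G HG x0 (x1 - x0) ltac:(lra)).
  replace (x0 + (x1 - x0)) with x1 in I by ring.
  specialize (I ltac:(intros s; unfold G; rewrite !cexp_opp, !cexp_2PI; reflexivity)).
  assert (B0 : forall t, Rabs (fst (G (x0, t)) - Cmod d * Cmod d) <= Cmod d * eps).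
  { intros t.
    eapply Rle_trans; [apply (Rabs_fst_le (G (x0, t)) (RtoC (Cmod d * Cmod d)))|].
    rewrite <- Cconj_mult_self; unfold G.
    rewrite cexp_opp.
    set (E := cexp (x0, t)).
    assert (HE : E <> RtoC 0) by apply cexp_neq_0.
    assert (HE' : Cmod E = exp x0) by apply Cmod_cexp.
    replace (_ - _)%C with (Cconj d * ((f (z + E) - f z - (z + E - z) * d) * / E))%C
      by (field; exact HE).
    rewrite !Cmod_mult, Cmod_conj, Cmod_inv by exact HE.
    specialize (Hlin (z + E)%C).
    replace (Cmod (z + E - z)) with (exp x0) in Hlin
      by (rewrite <- HE'; f_equal; ring).
    specialize (Hlin E0).
    assert (P := exp_pos x0).
    apply Rmult_le_compat_l; [lra|].
    rewrite HE'.
    apply Rmult_le_reg_r with (exp x0); [lra|].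
    rewrite Rmult_assoc, Rinv_l, Rmult_1_r by lra; exact Hlin. }
  assert (B1 : forall t, Rabs (fst (G (x1, t))) <= Cmod d * (2 * M / r)).
  { intros t.
    assert (A := Rabs_fst_le (G (x1, t)) 0).
    simpl (fst (RtoC 0)) in A; rewrite Rminus_0_r in A.
    eapply Rle_trans; [exact A|].
    replace (G (x1, t) - 0)%C with (G (x1, t)) by ring.
    unfold G; rewrite cexp_opp.
    set (E := cexp (x1, t)).
    assert (HE : E <> RtoC 0) by apply cexp_neq_0.
    assert (HE' : Cmod E = r) by (rewrite <- E1; apply Cmod_cexp).
    rewrite !Cmod_mult, Cmod_conj, Cmod_inv by exact HE.
    apply Rmult_le_compat_l; [lra|].
    rewrite HE'; apply Rmult_le_compat_r; [left; now apply Rinv_0_lt_compat|].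
    assert (F : Cmod (f (z + E)%C) <= M).
    { apply HM; replace (z + E - z)%C with E by ring; lra. }
    assert (T := Cmod_triangle (f (z + E)%C) (- f z)).
    rewrite Cmod_opp in T; unfold Cminus; lra. }
  assert (K : Rabs (vert_int G x0 0 (2 * PI) - vert_int G x1 0 (2 * PI)
      - Cmod d * Cmod d * (2 * PI))
    <= 2 * PI * (Cmod d * eps + Cmod d * (2 * M / r))).
  { apply RInt_diff_const; try apply ex_RInt_vert, HG; [lra|].
    intros t _; specialize (B0 t); specialize (B1 t).
    apply Rabs_le_between in B0; apply Rabs_le_between in B1.
    apply Rabs_le; lra. }
  (* The two vertical integrals are equal and drop out; what is left is an upper bound for
     [Cmod d ^ 2 * (2 * PI)], to be divided by [Cmod d * (2 * PI)]. *)
  rewrite I in K; apply Rabs_le_between in K; destruct K as [K _].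
  apply Rmult_le_reg_l with (Cmod d * (2 * PI)); [nra|]. nra.
Qed.

(** * Finite suprema over the plane *)

(** The set of values is nonempty, so its supremum is not [m_infty]; being below [p_infty] it is
    finite, and [real] returns the true value rather than its default 0. *)
Lemma supC_ub (g : C -> R) : Rbar_lt (supC g) p_infty -> forall z, g z <= real (supC g).
Proof.
  intros H z.
  destruct (Lub_Rbar_correct (fun x => exists z, x = g z)) as [U _].
  specialize (U (g z) (ex_intro _ z eq_refl)); unfold supC in *.
  destruct (Lub_Rbar _); simpl in *; auto; contradiction.
Qed.

Lemma supC_le (g : C -> R) (M : R) : (forall z, g z <= M) ->
  Rbar_lt (supC g) p_infty /\ real (supC g) <= M.
Proof.
  intros H.
  destruct (Lub_Rbar_correct (fun x => exists z, x = g z)) as [U L].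
  specialize (U (g 0) (ex_intro _ (RtoC 0) eq_refl)); unfold supC in *.
  specialize (L (Finite M) ltac:(intros x [z ->]; apply H)).
  destruct (Lub_Rbar _); simpl in *; auto; contradiction.
Qed.

(** * Growth of the weight and of functions along rays *)

Lemma is_derive_psi_rad (m : nat) (t : R) : 0 <= t ->
  is_derive (psi_rad m) t (t - INR m / (1 + t)).
Proof.
  intros Ht; unfold psi_rad; auto_derive; [lra|field; lra].
Qed.

Lemma psi_rad_0 (m : nat) : psi_rad m 0 = 0.
Proof.
  unfold psi_rad; rewrite Rplus_0_r, ln_1; ring.
Qed.

(** Combine [ln (1 + t) <= t] with the square of [t - (m + 1)]. This both dominates [t] by a
    multiple of [exp psi] and bounds [psi] from below. *)
Lemma psi_rad_ge (m : nat) (t : R) : 0 <= t -> t - (INR m + 1) ^ 2 / 2 <= psi_rad m t.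
Proof.
  intros Ht; unfold psi_rad.
  assert (Hm := pos_INR m).
  assert (L : ln (1 + t) <= t).
  { rewrite <- (ln_exp t) at 2; apply ln_le; [lra|apply exp_ineq1_le]. }
  assert (INR m * ln (1 + t) <= INR m * t) by (apply Rmult_le_compat_l; lra).
  assert (P := pow2_ge_0 (t - (INR m + 1))).
  nra.
Qed.

Lemma psi_rad_le (m : nat) (t : R) : 0 <= t -> psi_rad m t <= t ^ 2 / 2.
Proof.
  intros Ht; unfold psi_rad.
  assert (Hm := pos_INR m).
  assert (0 <= ln (1 + t)) by (rewrite <- ln_1; apply ln_le; lra).
  assert (0 <= INR m * ln (1 + t)) by (apply Rmult_le_pos; lra).
  lra.
Qed.

(** Since [m / (1 + t) <= m], replacing [t] by [psi'] loses at most the additive constant [m]. *)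
Lemma dpsi_weight_ge (m : nat) (t : R) : 0 <= t ->
  1 + t <= (INR m + 1) * (1 + Rabs (t - INR m / (1 + t))).
Proof.
  intros Ht.
  assert (Hm := pos_INR m).
  assert (H := Rle_abs (t - INR m / (1 + t))).
  assert (Hp := Rabs_pos (t - INR m / (1 + t))).
  assert (INR m / (1 + t) <= INR m).
  { apply Rmult_le_reg_r with (1 + t); [lra|].
    replace (INR m / (1 + t) * (1 + t)) with (INR m) by (field; lra); nra. }
  nra.
Qed.

(** For [p = psi' t] on [[0, m + 1]] one has [|p| <= 2 m + 1], hence [1 + |p| - 2 p <= 6 m + 4]; the
    exponential bounds [exp psi] on the same interval. *)
Definition growth_const (m : nat) : R := (6 * INR m + 4) * exp ((INR m + 1) ^ 2 / 2).

(* [2 exp psi] has a large enough derivative beyond [m + 1], where [psi' >= 1];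
   the linear term takes care of [0, m + 1]. *)
Lemma growth_majorant_derive (m : nat) (t : R) : 0 <= t ->
  let p := t - INR m / (1 + t) in
  (1 + Rabs p) * exp (psi_rad m t) <= 2 * (p * exp (psi_rad m t)) + growth_const m.
Proof.
  intros Ht p.
  assert (Hm := pos_INR m).
  assert (Hq : 0 <= INR m / (1 + t) <= INR m).
  { split.
    - apply Rmult_le_pos; [lra|left; apply Rinv_0_lt_compat; lra].
    - apply Rmult_le_reg_r with (1 + t); [lra|].
      replace (INR m / (1 + t) * (1 + t)) with (INR m) by (field; lra); nra. }
  assert (He := exp_pos (psi_rad m t)).
  assert (HE := exp_pos ((INR m + 1) ^ 2 / 2)).
  assert (0 <= growth_const m) by (unfold growth_const; nra).
  destruct (Rle_dec (INR m + 1) t) as [Hc|Hc].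
  - assert (1 <= p) by (unfold p; lra).
    rewrite Rabs_pos_eq by lra; nra.
  - assert (Hpsi : exp (psi_rad m t) <= exp ((INR m + 1) ^ 2 / 2)).
    { apply exp_le_compat; eapply Rle_trans; [now apply psi_rad_le|]; nra. }
    assert (Hp : Rabs p <= 2 * INR m + 1) by (apply Rabs_le; unfold p; lra).
    assert (Hp' := Rle_abs (- p)); rewrite Rabs_Ropp in Hp'.
    assert (B : (1 + Rabs p - 2 * p) * exp (psi_rad m t)
      <= (6 * INR m + 4) * exp ((INR m + 1) ^ 2 / 2)).
    { apply Rle_trans with ((6 * INR m + 4) * exp (psi_rad m t)).
      - apply Rmult_le_compat_r; lra.
      - apply Rmult_le_compat_l; lra. }
    unfold growth_const; lra.
Qed.

(** The function [h], majorant minus [phi], has a nonnegative derivative. The mean value theorem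
    thus takes the place of integrating [dphi], whose continuity is not known. *)
Lemma growth_bound (m : nat) (phi dphi : R -> R) (S rho : R) :
  0 <= rho -> 0 <= S ->
  (forall t, 0 <= t -> is_derive phi t (dphi t)) ->
  (forall t, 0 <= t -> dphi t <= S * ((1 + Rabs (t - INR m / (1 + t))) * exp (psi_rad m t))) ->
  phi rho - phi 0 <=
    S * (2 + growth_const m * exp ((INR m + 1) ^ 2 / 2)) * exp (psi_rad m rho).
Proof.
  intros Hrho HS Hder Hb.
  set (L := growth_const m).
  assert (Hm := pos_INR m).
  assert (HE := exp_pos ((INR m + 1) ^ 2 / 2)).
  assert (HL : 0 <= L) by (unfold L, growth_const; nra).
  set (p t := t - INR m / (1 + t)).
  set (h t := S * (2 * exp (psi_rad m t) + L * t) - phi t).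
  set (dh t := S * (2 * (p t * exp (psi_rad m t)) + L) - dphi t).
  assert (Dh : forall t, 0 <= t -> is_derive h t (dh t)).
  { intros t Ht; unfold h, dh.
    apply (is_derive_minus (V := R_NormedModule)); [|now apply Hder].
    apply is_derive_scal.
    apply (is_derive_plus (V := R_NormedModule)).
    - apply is_derive_scal.
      apply (is_derive_comp (V := R_NormedModule) exp (psi_rad m)).
      + apply is_derive_exp.
      + now apply is_derive_psi_rad.
    - replace L with (L * 1) at 2 by ring; apply is_derive_scal.
      exact (is_derive_id (K := R_AbsRing) t). }
  destruct (MVT_gen h 0 rho dh) as [c [Hc E]].
  - rewrite Rmin_left, Rmax_right by lra; intros; apply Dh; lra.
  - rewrite Rmin_left, Rmax_right by lra; intros x Hx.
    apply derivable_continuous_pt; exists (dh x).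
    apply is_derive_Reals, Dh; lra.
  - rewrite Rmin_left, Rmax_right in Hc by lra.
    assert (Hdh : 0 <= dh c).
    { unfold dh.
      assert (A := Hb c ltac:(lra)).
      assert (A' := growth_majorant_derive m c ltac:(lra)); cbv zeta in A'.
      fold (p c) in A, A'; fold L in A'.
      apply (Rmult_le_compat_l S) in A'; lra. }
    assert (0 <= h rho - h 0) by (rewrite E; apply Rmult_le_pos; lra).
    unfold h in H; rewrite psi_rad_0, exp_0 in H.
    (* This absorbs the linear term [L * rho] of the majorant into [exp psi]. *)
    assert (Hr : rho <= exp ((INR m + 1) ^ 2 / 2) * exp (psi_rad m rho)).
    { rewrite <- exp_plus.
      apply Rle_trans with (exp rho).
      - assert (X := exp_ineq1_le rho); lra.
      - apply exp_le_compat; assert (X := psi_rad_ge m rho Hrho); lra. }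
    apply (Rmult_le_compat_l L) in Hr; [|lra].
    apply (Rmult_le_compat_l S) in Hr; [|lra].
    nra.
Qed.

(** The factor [u] projects the complex increment to a real function of [s], to which the mean value
    theorem applies. *)
Lemma is_derive_ray (f : C -> C) (u e d : C) (t : R) :
  Cmod e = 1 ->
  is_derive (K := C_AbsRing) (V := C_NormedModule) f (RtoC t * e)%C d ->
  is_derive (fun s : R => fst (u * f (RtoC s * e)%C)%C) t (fst (u * (e * d))%C).
Proof.
  intros He Hd.
  assert (Hu := Cmod_ge_0 u).
  split; [apply is_linear_scal_l|].
  intros x Hx.
  apply (is_filter_lim_locally_unique (K := R_AbsRing) (V := R_NormedModule)) in Hx.
  rewrite <- Hx; intros eps.
  assert (Heps : 0 < eps / (Cmod u + 1)) by (apply Rdiv_lt_0_compat; [apply cond_pos|lra]).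
  destruct (proj1 (is_derive_C_iff f _ d) Hd _ Heps) as [delta [Hd0 Hlin]].
  exists (mkposreal delta Hd0); intros s Hs.
  change (Rabs (s - t) < delta) in Hs.
  change (Rabs (fst (u * f (RtoC s * e)%C)%C - fst (u * f (RtoC t * e)%C)%C
    - (s - t) * fst (u * (e * d))%C) <= eps * Rabs (s - t)).
  assert (N : Cmod (RtoC s * e - RtoC t * e) = Rabs (s - t)).
  { replace (RtoC s * e - RtoC t * e)%C with (RtoC (s - t) * e)%C
      by (rewrite RtoC_minus; ring).
    rewrite Cmod_mult, Cmod_R, He; ring. }
  specialize (Hlin (RtoC s * e)%C); rewrite N in Hlin; specialize (Hlin Hs).
  set (A := f (RtoC s * e)%C) in *; set (B := f (RtoC t * e)%C) in *.
  set (D := (A - B - (RtoC s * e - RtoC t * e) * d)%C) in *.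
  replace (fst (u * A)%C - fst (u * B)%C - (s - t) * fst (u * (e * d))%C)
    with (fst (u * D)%C) by (unfold D; simpl; ring).
  eapply Rle_trans; [eapply Rle_trans; [apply Rmax_l|apply (Rmax_Cmod (u * D)%C)]|].
  rewrite Cmod_mult.
  apply Rle_trans with (Cmod u * (eps / (Cmod u + 1) * Rabs (s - t)));
    [apply Rmult_le_compat_l; lra|].
  assert (Hp := Rabs_pos (s - t)).
  assert (Hq : Cmod u * (eps / (Cmod u + 1)) <= eps).
  { replace (Cmod u * (eps / (Cmod u + 1))) with (eps - eps / (Cmod u + 1)) by (field; lra).
    lra. }
  rewrite <- Rmult_assoc; apply Rmult_le_compat_r; lra.
Qed.

(** * Bounding the derivative by the function *)

(** Moving by at most [1 / (1 + t)] raises the square by at most 3, whence [exp (3 / 2)], and gives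
    [1 + t <= 2 * (1 + s)], whence [2 ^ m] from the logarithm. *)
Lemma weight_nearby (m : nat) (s t : R) : 0 <= s -> 0 <= t ->
  Rabs (s - t) <= / (1 + t) ->
  exp (psi_rad m s) <= exp (3 / 2) * 2 ^ m * exp (psi_rad m t).
Proof.
  intros Hs Ht Hst.
  assert (Hm := pos_INR m).
  apply Rabs_le_between in Hst.
  assert (Hi : / (1 + t) * (1 + t) = 1) by (field; lra).
  assert (Hi0 : 0 < / (1 + t)) by (apply Rinv_0_lt_compat; lra).
  assert (Hi1 : / (1 + t) <= 1) by nra.
  assert (L : ln (1 + t) <= ln 2 + ln (1 + s)).
  { rewrite <- ln_mult by lra; apply ln_le; nra. }
  assert (L' : INR m * ln (1 + t) <= INR m * (ln 2 + ln (1 + s)))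
    by (apply Rmult_le_compat_l; lra).
  replace (2 ^ m) with (exp (INR m * ln 2))
    by (rewrite <- ln_pow, exp_ln; [reflexivity|apply pow_lt; lra|lra]).
  rewrite <- !exp_plus; apply exp_le_compat; unfold psi_rad.
  assert (Q : s ^ 2 <= t ^ 2 + 3) by nra.
  lra.
Qed.

(** The factors come from Cauchy's estimate, from [weight_nearby] and from [dpsi_weight_ge], in this
    order. *)
Definition deriv_const (m : nat) : R := 2 * (exp (3 / 2) * 2 ^ m) * (INR m + 1).

Lemma deriv_const_pos (m : nat) : 0 < deriv_const m.
Proof.
  unfold deriv_const.
  assert (H1 := exp_pos (3 / 2)).
  assert (H2 : 0 < 2 ^ m) by (apply pow_lt; lra).
  assert (H3 := pos_INR m).
  repeat apply Rmult_lt_0_compat; lra.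
Qed.

Lemma fock_deriv_bound (m : nat) (f : C -> C) (M : R) : entire f ->
  (forall z, Cmod (f z) * exp (- psi m z) <= M) ->
  forall z, Cmod (C_derive f z) * exp (- psi m z) / (1 + Rabs (dpsi m z))
    <= deriv_const m * M.
Proof.
  intros Hf HM z.
  assert (Hz := Cmod_ge_0 z).
  assert (Hm := pos_INR m).
  assert (HM0 : 0 <= M).
  { eapply Rle_trans; [|apply (HM z)].
    apply Rmult_le_pos; [apply Cmod_ge_0|left; apply exp_pos]. }
  assert (W : forall w, Cmod (f w) <= M * exp (psi m w)).
  { intros w; assert (P := exp_pos (psi m w)).
    specialize (HM w); apply (Rmult_le_compat_r (exp (psi m w))) in HM; [|lra].
    rewrite Rmult_assoc, <- exp_plus, Rplus_opp_l, exp_0 in HM; lra. }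
  assert (Hr : 0 < / (1 + Cmod z)) by (apply Rinv_0_lt_compat; lra).
  assert (HC := cauchy_estimate f z (/ (1 + Cmod z))
    (M * (exp (3 / 2) * 2 ^ m * exp (psi m z))) Hf Hr).
  assert (HC' : Cmod (C_derive f z)
    <= 2 * (M * (exp (3 / 2) * 2 ^ m * exp (psi m z))) / / (1 + Cmod z)).
  { apply HC; intros w Hw.
    eapply Rle_trans; [apply W|]; apply Rmult_le_compat_l; [lra|].
    apply weight_nearby; try apply Cmod_ge_0.
    eapply Rle_trans; [|exact Hw].
    assert (T1 := Cmod_triangle (w - z) z); assert (T2 := Cmod_triangle (z - w) w).
    replace (w - z + z)%C with w in T1 by ring.
    replace (z - w + w)%C with z in T2 by ring.
    replace (z - w)%C with (- (w - z))%C in T2 by ring; rewrite Cmod_opp in T2.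
    apply Rabs_le; lra. }
  unfold Rdiv in HC' at 1; rewrite Rinv_inv in HC'.
  rewrite dpsiE.
  assert (Wt := dpsi_weight_ge m (Cmod z) Hz).
  assert (Hp := Rabs_pos (Cmod z - INR m / (1 + Cmod z))).
  set (p := Rabs _) in *.
  assert (E := exp_pos (- psi m z)).
  apply Rmult_le_reg_r with (1 + p); [lra|].
  unfold Rdiv at 1; rewrite Rmult_assoc, Rinv_l, Rmult_1_r by lra.
  apply (Rmult_le_compat_r (exp (- psi m z))) in HC'; [|lra].
  eapply Rle_trans; [exact HC'|].
  assert (E1 : exp (psi m z) * exp (- psi m z) = 1)
    by (rewrite <- exp_plus, Rplus_opp_r; apply exp_0).
  set (K := exp (3 / 2) * 2 ^ m).
  assert (HK : 0 <= K).
  { apply Rmult_le_pos; [left; apply exp_pos|apply pow_le; lra]. }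
  replace (2 * (M * (K * exp (psi m z))) * (1 + Cmod z) * exp (- psi m z))
    with (2 * M * K * (1 + Cmod z) * (exp (psi m z) * exp (- psi m z))) by ring.
  rewrite E1; unfold deriv_const; fold K.
  replace (2 * K * (INR m + 1) * M * (1 + p))
    with (2 * M * K * ((INR m + 1) * (1 + p))) by ring.
  rewrite Rmult_1_r; apply Rmult_le_compat_l; [|exact Wt].
  apply Rmult_le_pos; [lra|exact HK].
Qed.

(** * Bounding the function by its derivative, and the equivalence of norms *)

(** The first summand bounds [exp (- psi)] and pays for [f 0]; the second pays for the increment
    [f z - f 0]. *)
Definition integral_const (m : nat) : R :=
  exp ((INR m + 1) ^ 2 / 2) + (2 + growth_const m * exp ((INR m + 1) ^ 2 / 2)).

Lemma integral_const_pos (m : nat) : 0 < integral_const m.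
Proof.
  unfold integral_const, growth_const.
  assert (H1 := exp_pos ((INR m + 1) ^ 2 / 2)).
  assert (H3 := pos_INR m).
  nra.
Qed.

Lemma fock_increment_bound (m : nat) (f : C -> C) (S : R) : entire f ->
  (forall z, Cmod (C_derive f z) * exp (- psi m z) / (1 + Rabs (dpsi m z)) <= S) ->
  forall z, Cmod (f z - f 0) <=
    S * (2 + growth_const m * exp ((INR m + 1) ^ 2 / 2)) * exp (psi m z).
Proof.
  intros Hf HS z.
  assert (Hm := pos_INR m).
  assert (HE := exp_pos ((INR m + 1) ^ 2 / 2)).
  assert (HL : 0 <= growth_const m) by (unfold growth_const; nra).
  assert (W : forall w, Cmod (C_derive f w)
    <= S * ((1 + Rabs (dpsi m w)) * exp (psi m w))).
  { intros w; specialize (HS w).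
    assert (P := exp_pos (psi m w)); assert (Q := Rabs_pos (dpsi m w)).
    rewrite exp_Ropp in HS.
    apply (Rmult_le_compat_r ((1 + Rabs (dpsi m w)) * exp (psi m w))) in HS; [|nra].
    eapply Rle_trans; [right|exact HS]; field; lra. }
  assert (HS0 : 0 <= S).
  { eapply Rle_trans; [|apply (HS z)].
    assert (Q := Rabs_pos (dpsi m z)).
    apply Rmult_le_pos; [|left; apply Rinv_0_lt_compat; lra].
    apply Rmult_le_pos; [apply Cmod_ge_0|left; apply exp_pos]. }
  set (K := S * (2 + growth_const m * exp ((INR m + 1) ^ 2 / 2))).
  assert (HK : 0 <= K) by (unfold K; apply Rmult_le_pos; nra).
  assert (HP := exp_pos (psi m z)).
  (* The origin is treated apart because it determines no unit direction [e]. *)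
  destruct (Req_dec (Cmod z) 0) as [Hz|Hz].
  { apply Cmod_eq_0 in Hz; subst z.
    replace (f 0 - f 0)%C with (RtoC 0) by ring; rewrite Cmod_0; nra. }
  assert (Hz0 := Cmod_ge_0 z).
  set (rho := Cmod z) in *.
  set (e := (z * RtoC (/ rho))%C).
  assert (He : Cmod e = 1).
  { unfold e; rewrite Cmod_mult, Cmod_R, Rabs_pos_eq;
      [fold rho; field; lra|left; apply Rinv_0_lt_compat; lra]. }
  assert (Ez : (RtoC rho * e)%C = z).
  { unfold e; replace (RtoC rho * (z * RtoC (/ rho)))%C with (z * (RtoC (rho * / rho)))%C
      by (rewrite RtoC_mult; ring).
    rewrite Rinv_r by lra; ring. }
  (* With this [u] the real part of [u * (f z - f 0)] is [Cmod u ^ 2], so cancelling one factor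
     [Cmod u] bounds the increment itself. *)
  set (u := Cconj (f z - f 0)%C).
  assert (Hu : Cmod u = Cmod (f z - f 0)) by apply Cmod_conj.
  assert (Hu0 := Cmod_ge_0 u).
  assert (G := growth_bound m (fun s => fst (u * f (RtoC s * e)%C)%C)
    (fun t => fst (u * (e * C_derive f (RtoC t * e)%C))%C) (Cmod u * S) rho Hz0
    ltac:(apply Rmult_le_pos; lra)
    ltac:(intros t _; apply is_derive_ray; [exact He|apply entire_C_derive, Hf])).
  assert (B : forall t, 0 <= t -> fst (u * (e * C_derive f (RtoC t * e)%C))%C
    <= Cmod u * S * ((1 + Rabs (t - INR m / (1 + t))) * exp (psi_rad m t))).
  { intros t Ht.
    assert (Et : Cmod (RtoC t * e) = t)
      by (rewrite Cmod_mult, Cmod_R, He, Rabs_pos_eq; lra).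
    specialize (W (RtoC t * e)%C); rewrite dpsiE in W; unfold psi in W; rewrite Et in W.
    eapply Rle_trans; [apply Rle_abs|].
    eapply Rle_trans; [eapply Rle_trans; [apply Rmax_l|apply Rmax_Cmod]|].
    rewrite !Cmod_mult, He, Rmult_1_l, Rmult_assoc.
    apply Rmult_le_compat_l; auto. }
  specialize (G B); cbv beta in G.
  rewrite Ez in G; replace (RtoC 0 * e)%C with (RtoC 0) in G by ring.
  replace (fst (u * f z)%C - fst (u * f 0)%C) with (Cmod u * Cmod u) in G.
  - change (psi_rad m rho) with (psi m z) in G.
    rewrite <- Hu; destruct Hu0 as [Hu0|Hu0]; [|rewrite <- Hu0; nra].
    apply Rmult_le_reg_l with (Cmod u); [exact Hu0|].
    eapply Rle_trans; [exact G|right; unfold K; ring].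
  - replace (fst (u * f z)%C - fst (u * f 0)%C) with (fst (u * (f z - f 0))%C)
      by (simpl; ring).
    unfold u at 3; rewrite Cconj_mult_self, Hu; reflexivity.
Qed.

Lemma fock_bound (m : nat) (f : C -> C) (S : R) : entire f ->
  (forall z, Cmod (C_derive f z) * exp (- psi m z) / (1 + Rabs (dpsi m z)) <= S) ->
  forall z, Cmod (f z) * exp (- psi m z) <= integral_const m * (Cmod (f 0) + S).
Proof.
  intros Hf HS z.
  assert (I := fock_increment_bound m f S Hf HS z).
  set (K := 2 + growth_const m * exp ((INR m + 1) ^ 2 / 2)) in *.
  assert (T := Cmod_triangle (f z - f 0) (f 0)).
  replace (f z - f 0 + f 0)%C with (f z) in T by ring.
  assert (E := exp_pos (- psi m z)).
  assert (E1 : exp (psi m z) * exp (- psi m z) = 1)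
    by (rewrite <- exp_plus, Rplus_opp_r; apply exp_0).
  (* For [m >= 1] the function [psi] takes negative values, so [exp (- psi)] is bounded by a
     constant that may exceed 1. *)
  assert (E2 : exp (- psi m z) <= exp ((INR m + 1) ^ 2 / 2)).
  { apply exp_le_compat; unfold psi.
    assert (X := psi_rad_ge m (Cmod z) (Cmod_ge_0 z)).
    assert (Y := Cmod_ge_0 z); lra. }
  assert (HS0 : 0 <= S).
  { eapply Rle_trans; [|apply (HS z)].
    assert (Q := Rabs_pos (dpsi m z)).
    apply Rmult_le_pos; [|left; apply Rinv_0_lt_compat; lra].
    apply Rmult_le_pos; [apply Cmod_ge_0|lra]. }
  assert (H0 := Cmod_ge_0 (f 0)).
  assert (HK : 0 <= K).
  { unfold K, growth_const.
    assert (HE := exp_pos ((INR m + 1) ^ 2 / 2)); assert (Hm := pos_INR m); nra. }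
  apply Rle_trans with ((S * K * exp (psi m z) + Cmod (f 0)) * exp (- psi m z)).
  - apply Rmult_le_compat_r; lra.
  - replace ((S * K * exp (psi m z) + Cmod (f 0)) * exp (- psi m z))
      with (S * K * (exp (psi m z) * exp (- psi m z)) + Cmod (f 0) * exp (- psi m z)) by ring.
    rewrite E1; unfold integral_const; fold K.
    assert (Cmod (f 0) * exp (- psi m z) <= Cmod (f 0) * exp ((INR m + 1) ^ 2 / 2))
      by (apply Rmult_le_compat_l; lra).
    assert (0 <= S * exp ((INR m + 1) ^ 2 / 2)) by (apply Rmult_le_pos; lra).
    assert (0 <= Cmod (f 0) * K) by (apply Rmult_le_pos; lra).
    lra.
Qed.

Theorem lemma2p1 (m : nat) :
  (forall f : C -> C, entire f ->
     (fock_space m f <-> Rbar_lt (fock_deriv_sup m f) p_infty)) /\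
  comparable_on (fock_space m)
    (fun f : C -> C => fock_norm m f)
    (fun f : C -> C => Cmod (f (RtoC 0)) + real (fock_deriv_sup m f)).
Proof.
  assert (to_deriv : forall f, fock_space m f ->
    Rbar_lt (fock_deriv_sup m f) p_infty /\
    real (fock_deriv_sup m f) <= deriv_const m * fock_norm m f).
  { intros f [Hf Hs].
    apply supC_le, fock_deriv_bound; [exact Hf|].
    exact (supC_ub _ Hs). }
  assert (from_deriv : forall f, entire f -> Rbar_lt (fock_deriv_sup m f) p_infty ->
    Rbar_lt (fock_sup m f) p_infty /\
    fock_norm m f <= integral_const m * (Cmod (f 0) + real (fock_deriv_sup m f))).
  { intros f Hf Hs.
    apply supC_le, fock_bound; [exact Hf|].
    exact (supC_ub _ Hs). }
  split.
  - intros f Hf; split.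
    + intros Hs; now apply to_deriv.
    + intros Hs; split; [exact Hf|now apply from_deriv].
  - assert (Hi := integral_const_pos m); assert (Hd := deriv_const_pos m).
    (* The summand 1 pays for [f 0], the second for the supremum of the derivative, the third for
       the converse estimate. *)
    exists (1 + deriv_const m + integral_const m); split; [lra|].
    intros f Hfs.
    destruct (to_deriv f Hfs) as [Hs Hle].
    destruct (from_deriv f (proj1 Hfs) Hs) as [_ Hle'].
    (* As [psi] vanishes at the origin, [Cmod (f 0)] is one of the values in the supremum. *)
    assert (H0 : Cmod (f 0) <= fock_norm m f).
    { assert (A := supC_ub _ (proj2 Hfs) 0); cbv beta in A.
      unfold psi in A; rewrite Cmod_0, psi_rad_0, Ropp_0, exp_0, Rmult_1_r in A.
      exact A. }
    assert (HS0 : 0 <= real (fock_deriv_sup m f)).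
    { eapply Rle_trans; [|exact (supC_ub _ Hs 0)].
      assert (Q := Rabs_pos (dpsi m 0)).
      apply Rmult_le_pos; [|left; apply Rinv_0_lt_compat; lra].
      apply Rmult_le_pos; [apply Cmod_ge_0|left; apply exp_pos]. }
    assert (Hf0 := Cmod_ge_0 (f 0)).
    split; nra.
Qed.
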